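(* Let $f:\mathbb{R}\to\mathbb{R}$ be a Lebesgue measurable function for which there exists $L>0$ such that $|f(x)-f(y)|\geq L|x-y|$ for all $x,y\in\mathbb{R}$. Let $G:\mathbb{R}\to\mathbb{R}$ be Lebesgue integrable on $\mathbb{R}$. Then $G\circ f$ is Lebesgue integrable on $\mathbb{R}$.
   Context: Lebesgue measurability and integrability are with respect to Lebesgue measure on $\mathbb{R}$ and the sigma-algebra of Lebesgue measurable sets; a function $f:\mathbb{R}\to\mathbb{R}$ is Lebesgue measurable if the preimage of every Borel set is Lebesgue measurable. *)

(* Defs.v *)
From HB Require Import structures.
From mathcomp Require Import all_boot all_order all_algebra.
From mathcomp Require Import all_classical all_reals all_analysis.
Set Implicit Arguments.
Unset Strict Implicit.
Unset Printing Implicit Defensive.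
Import Order.TTheory GRing.Theory Num.Theory.
Import numFieldNormedType.Exports.
Local Open Scope classical_set_scope.
Local Open Scope ring_scope.

(* The reals with the sigma-algebra of Lebesgue measurable (Caratheodory) sets,
   which is the domain of [completed_lebesgue_measure]. A bare [R] used as a
   measurable type carries the Borel sigma-algebra instead. *)
Definition lebesgueType (R : realType) : measurableType _ :=
  caratheodory_type (@wlength R idfun)^*%mu.

Definition lebesgue_measurable_fun (R : realType) (f : R -> R) : Prop :=
  measurable_fun [set: lebesgueType R] (f : lebesgueType R -> R).

Definition lebesgue_integrable (R : realType) (g : R -> R) : Prop :=
  completed_lebesgue_measure.-integrable [set: lebesgueType R] (EFin \o g).

(* Main.v *)
Require Import Defs.
From HB Require Import structures.
From mathcomp Require Import all_boot all_order all_algebra.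
From mathcomp Require Import all_classical all_reals all_analysis.
From mathcomp Require Import measurable_realfun lra.
Import Order.TTheory GRing.Theory Num.Theory.
Import numFieldNormedType.Exports.
Local Open Scope classical_set_scope.
Local Open Scope ring_scope.

(** Since [f] expands distances by at least [L], it pulls a set of diameter [d]
    back to a set of diameter at most [d / L]. Pulling back the intervals of a
    near-optimal cover of a set [E] therefore shows that the Lebesgue outer measure
    of [f @^-1` E] is at most [L^-1] times that of [E], for every set [E]
    ([outer_lebesgue_preimage_le]). This single estimate is used twice.

    It first shows that [f] pulls null sets back to null sets, so that the
    preimage of any Lebesgue measurable set, being a Borel set up to a null set,
    is Lebesgue measurable ([measurable_expanding]). This matters because
    Lebesgue measurability of [f] only speaks of preimages of Borel sets, while
    [G] is only Lebesgue measurable: for a general [f], the function [G \o f]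
    could fail to be measurable.

    It then says that the image under [f] of Lebesgue measure is at most [L^-1]
    times Lebesgue measure, so that the change of variables formula bounds the
    integral of [`|G \o f|] by [L^-1] times that of [`|G|]
    ([integrable_comp_of_pushforward_le]). *)

Local Notation outer_lebesgue R := ((@wlength R idfun)^*%mu).

(** When [S] is nonempty its supremum is finite, and every point of [S] is at
    distance at most [d] below it: [S] lies in a closed interval of length [d]. *)
Lemma outer_lebesgue_le_diam (R : realType) (S : set R) (d : R) :
  0 <= d -> (forall x y, S x -> S y -> `|x - y| <= d) ->
  (outer_lebesgue R S <= d%:E)%E.
Proof.
move=> d0 diamS; have [->|/set0P[x0 Sx0]] := eqVneq S set0.
  by rewrite (outer_measure0 (outer_lebesgue R)) lee_fin.
have supS x : S x -> sup S <= x + d.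
  move=> Sx; apply: ge_sup; first by exists x0.
  by move=> y Sy; have := diamS _ _ Sy Sx; rewrite ler_norml lerBlDl => /andP[].
have subS : S `<=` `[sup S - d, sup S]%classic.
  move=> x Sx; rewrite /= in_itv/= lerBlDr supS//=.
  by apply: ub_le_sup => //; exists (x0 + d) => y Sy;
     have := diamS _ _ Sy Sx0; rewrite ler_norml lerBlDl => /andP[].
apply: (le_trans (le_outer_measure (outer_lebesgue R) _ _ subS)).
(* Lebesgue measure is by definition the restriction of the outer measure. *)
rewrite -[X in (X <= _)%E]/(lebesgue_measure `[sup S - d, sup S]%classic).
rewrite lebesgue_measure_itv/= lte_fin; case: ifPn => _; last by rewrite lee_fin.
by rewrite -EFinD lee_fin opprB addrCA subrr addr0.
Qed.

(** Outer measure is an infimum over covers, and a cover of [E] by half-open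
    intervals pulls back to a cover of [f @^-1` E] by sets whose
    diameters are controlled by the lengths of the intervals. *)
Lemma outer_lebesgue_preimage_le (R : realType) (f : R -> R) (L : R) :
  0 < L -> (forall x y, L * `|x - y| <= `|f x - f y|) -> forall E : set R,
  (outer_lebesgue R (f @^-1` E) <=
    L^-1%:E * outer_lebesgue R E)%E.
Proof.
move=> L0 hf E.
have itvP (I : set (ocitv_type R)) : measurable I ->
    (outer_lebesgue R (f @^-1` I) <= L^-1%:E * wlength idfun I)%E.
  case=> -[a b] _ /= <-; rewrite wlength_itv/= lte_fin.
  case: ifPn => ab; last first.
    rewrite set_itv_ge ?bnd_simp// mule0 preimage_set0.
    by rewrite (outer_measure0 (outer_lebesgue R)).
  have ab0 : 0 <= L^-1 * (b - a) by rewrite mulr_ge0// ?invr_ge0 ?subr_ge0 ltW.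
  rewrite -EFinD -EFinM; apply: outer_lebesgue_le_diam => // x y /=.
  rewrite !in_itv/= => /andP[ax xb] /andP[ay yb].
  rewrite ler_pdivlMl//; apply: (le_trans (hf x y)).
  by rewrite ler_norml; apply/andP; split; lra.
(* Moving the constant to the left exposes the infimum over covers, which is
   then bounded below cover by cover. *)
rewrite -lee_pdivrMl ?invr_gt0// invrK.
apply: le_ereal_inf_tmp => _ [A [mA EA] <-].
rewrite -[L]invrK lee_pdivrMl ?invr_gt0// -nneseriesZl; last first.
  by move=> k _; exact: wlength_ge0.
apply: (le_trans (le_outer_measure (outer_lebesgue R) _
  (\bigcup_k (f @^-1` A k)) _)).
  by rewrite -preimage_bigcup; exact: preimage_subset.
apply: (le_trans (outer_measure_sigma_subadditive _ _)).
by apply: lee_nneseries => k _ //; apply: itvP.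
Qed.

(** A Lebesgue measurable set is a Borel set [B] together with a part [N] of a
    Borel null set [A]. The preimage of [A] is null by the outer measure
    estimate, and completeness of Lebesgue measure makes the preimage of [N]
    measurable. *)
Lemma measurable_expanding (R : realType) (f : R -> R) (L : R) :
  0 < L -> (forall x y, L * `|x - y| <= `|f x - f y|) ->
  lebesgue_measurable_fun f ->
  measurable_fun [set: lebesgueType R] (f : lebesgueType R -> lebesgueType R).
Proof.
move=> L0 hf mf _ Y mY; rewrite setTI.
have : completed_algebra_gen lebesgue_measure Y.
  by rewrite -g_sigma_completed_algebra_genE completed_caratheodory_measurable.
move=> [B mB [N [A [mA A0 NA]] <-]]; rewrite preimage_setU.
apply: measurableU.
  by rewrite -[X in measurable X]setTI; exact: mf.
apply: completed_lebesgue_measure_is_complete.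
exists (f @^-1` A); split; last exact: preimage_subset.
  by rewrite -[X in measurable X]setTI; exact: mf.
apply/eqP; rewrite eq_le measure_ge0 andbT.
apply: (le_trans (outer_lebesgue_preimage_le _ _ _ L0 hf A)).
by rewrite [X in (_ * X)%E]A0 mule0.
Qed.

(** The integral of [`|g \o phi|] is that of [`|g|] against the image measure
    of [mu], and the integral of a nonnegative function is monotone in the
    measure. *)
Lemma integrable_comp_of_pushforward_le d1 d2 (X : measurableType d1)
    (Y : measurableType d2) (R : realType) (mu : {measure set X -> \bar R})
    (nu : {measure set Y -> \bar R}) (phi : X -> Y) (k : {nonneg R})
    (g : Y -> \bar R) :
  measurable_fun setT phi ->
  (forall S, measurable S -> mu (phi @^-1` S) <= k%:num%:E * nu S)%E ->
  nu.-integrable setT g -> mu.-integrable setT (g \o phi).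
Proof.
move=> mphi munu /integrableP[mg ig].
apply/integrableP; split; first exact: measurableT_comp.
have mabsg : measurable_fun setT (fun y => `|g y|)%E by exact: measurableT_comp.
have <- : (\int[pushforward mu phi]_y `|g y| = \int[mu]_x `|(g \o phi) x|)%E.
  by rewrite (ge0_integral_pushforward mphi mu measurableT mabsg).
(* Bundling [phi] with its measurability makes its image measure a measure. *)
pose phi_mixin := isMeasurableFun.Build _ _ _ _ _ mphi.
pose phi_pack : {mfun X >-> Y} := HB.pack phi phi_mixin.
apply: (@le_lt_trans _ _ (\int[mscale k nu]_y `|g y|)%E).
  exact: (@ge0_le_measure_integral _ _ _ (pushforward mu phi_pack)).
by rewrite ge0_integral_mscale// lte_mul_pinfty ?lee_fin.
Qed.

Theorem corollary4p1 (R : realType) (f G : R -> R)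
    (mf : lebesgue_measurable_fun f)
    (hf : exists2 L : R, 0 < L &
            forall x y : R, L * `|x - y| <= `|f x - f y|)
    (iG : lebesgue_integrable G) :
  lebesgue_integrable (G \o f).
Proof.
case: hf => L L0 hf.
have Linv0 : 0 <= L^-1 by rewrite invr_ge0 ltW.
apply: (integrable_comp_of_pushforward_le _ _ _ _ _ _ _ _ (NngNum Linv0) _
  (measurable_expanding _ _ _ L0 hf mf) _ iG).
by move=> S _; exact: outer_lebesgue_preimage_le.
Qed.
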